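(* Let $E$ be a real Banach space with norm $|\cdot|$, let $P\subset E$ be a cone, and let $b:P\times P\to P$ be a bilinear and compact form satisfying the coercivity condition $$\inf_{u\in P,\ |u|=1} |b(u,u)|>0 .$$ Let $|b|$ denote the norm of $b$. Then for every $u_0\in P$ with $$4\,|b|\,|u_0|<1$$ the equation $$u=b(u,u)+u_0$$ has at least two distinct solutions $u\in P$.
   Context: A cone $P$ in a real Banach space $E$ is a closed convex subset with $P\neq\{0\}$, $P\ne\emptyset$, such that $\lambda x\in P$ for all $x\in P$ and $\lambda\ge 0$, and such that $x\in P$ and $-x\in P$ imply $x=0$. A map $b:P\times P\to P$ is bilinear if it is additive and positively homogeneous in each argument separately, i.e. $b(\lambda u+\mu v,w)=\lambda b(u,w)+\mu b(v,w)$ and $b(w,\lambda u+\mu v)=\lambda b(w,u)+\mu b(w,v)$ for all $u,v,w\in P$ and $\lambda,\mu\ge 0$. It is compact if it is continuous and maps bounded subsets of $P\times P$ to relatively compact subsets of $E$. The norm $|b|$ of $b$ is the least constant $B\ge 0$ such that $|b(u,v)|\le B|u||v|$ for all $u,v\in P$. *)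

(* Defs.v *)
From HB Require Import structures.
From mathcomp Require Import all_boot all_order all_algebra.
From mathcomp Require Import all_classical all_reals all_analysis.

Set Implicit Arguments.
Unset Strict Implicit.
Unset Printing Implicit Defensive.

Import Order.TTheory GRing.Theory Num.Theory.
Import numFieldNormedType.Exports.

Local Open Scope classical_set_scope.
Local Open Scope ring_scope.

Record is_cone (R : realType) (E : completeNormedModType R) (P : set E) :
    Prop := IsCone {
  cone_closed : closed P ;
  cone_convex : convex_set P ;
  cone_neq_set1 : P <> [set 0] ;
  cone_neq_set0 : P <> set0 ;
  cone_scale : forall (a : R) (x : E), P x -> 0 <= a -> P (a *: x) ;
  cone_pointed : forall x : E, P x -> P (- x) -> x = 0
}.

(* A form P x P -> P is encoded as a total function b : E -> E -> E that maps
   P x P into P; no hypothesis or definition below depends on its values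
   outside P x P. *)
Definition maps_cone (R : realType) (E : completeNormedModType R) (P : set E)
    (b : E -> E -> E) : Prop :=
  forall u v : E, P u -> P v -> P (b u v).

Definition cone_bilinear (R : realType) (E : completeNormedModType R)
    (P : set E) (b : E -> E -> E) : Prop :=
  forall (u v w : E) (l m : R), P u -> P v -> P w -> 0 <= l -> 0 <= m ->
    b (l *: u + m *: v) w = l *: b u w + m *: b v w /\
    b w (l *: u + m *: v) = l *: b w u + m *: b w v.

Definition cone_compact (R : realType) (E : completeNormedModType R)
    (P : set E) (b : E -> E -> E) : Prop :=
  {within P `*` P, continuous (fun p : E * E => b p.1 p.2)} /\
  forall A : set (E * E), A `<=` P `*` P -> bounded_set A ->
    precompact ((fun p : E * E => b p.1 p.2) @` A).

Definition form_bounds (R : realType) (E : completeNormedModType R)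
    (P : set E) (b : E -> E -> E) : set R :=
  [set B : R | 0 <= B /\
     forall u v : E, P u -> P v -> `|b u v| <= B * `|u| * `|v|].

(* The real-valued inf is 0 on the empty set; form_norm_least shows that for a
   compact bilinear form the infimum is a genuine minimum. *)
Definition form_norm (R : realType) (E : completeNormedModType R)
    (P : set E) (b : E -> E -> E) : R :=
  inf (form_bounds P b).

(* For a cone P the set below is nonempty, so inf has its usual meaning. *)
Definition coercivity_const (R : realType) (E : completeNormedModType R)
    (P : set E) (b : E -> E -> E) : R :=
  inf [set `|b u u| | u in [set u : E | P u /\ `|u| = 1]].

Lemma form_norm_least (R : realType) (E : completeNormedModType R)
    (P : set E) (b : E -> E -> E) :
  is_cone P -> cone_bilinear P b -> cone_compact P b ->
  form_bounds P b (form_norm P b) /\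
  forall B : R, form_bounds P b B -> form_norm P b <= B.
Proof.
move=> cP bl [_ cpt].
have b0l v : P v -> b 0 v = 0.
  move=> Pv; have [+ _] := bl v v v 0 0 Pv Pv Pv (lexx _) (lexx _).
  by rewrite !scale0r addr0.
have b0r v : P v -> b v 0 = 0.
  move=> Pv; have [_ +] := bl v v v 0 0 Pv Pv Pv (lexx _) (lexx _).
  by rewrite !scale0r addr0.
have bZl (l : R) u v : P u -> P v -> 0 <= l -> b (l *: u) v = l *: b u v.
  move=> Pu Pv l0; have [+ _] := bl u u v l 0 Pu Pu Pv l0 (lexx _).
  by rewrite !scale0r !addr0.
have bZr (l : R) u v : P u -> P v -> 0 <= l -> b v (l *: u) = l *: b v u.
  move=> Pu Pv l0; have [_ +] := bl u u v l 0 Pu Pu Pv l0 (lexx _).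
  by rewrite !scale0r !addr0.
pose A := [set p : E * E | [/\ P p.1, P p.2, `|p.1| <= 1 & `|p.2| <= 1]].
have AP : A `<=` P `*` P by move=> p [].
have bA : bounded_set A.
  exists 1; split; first exact: num_real.
  move=> M M1 p [_ _ p1 p2] /=; rewrite prod_normE ge_max.
  by rewrite (le_trans p1 (ltW M1)) (le_trans p2 (ltW M1)).
have [U AU [/compact_bounded[M0 [_ hM0]] _]] := cpt A AP bA.
pose M := `|M0| + 1.
have M_ge0 : 0 <= M by rewrite addr_ge0.
have hM p : A p -> `|b p.1 p.2| <= M.
  move=> Ap; apply: hM0; last by apply: AU; exists p.
  by rewrite (le_lt_trans (ler_norm _))// ltrDl.
have neb : form_bounds P b !=set0.
  exists M; split=> // u v Pu Pv.
  have [->|u0] := eqVneq u 0; first by rewrite b0l// !normr0 mulr0 mul0r.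
  have [->|v0] := eqVneq v 0; first by rewrite b0r// !normr0 mulr0.
  have nu : 0 < `|u| by rewrite normr_gt0.
  have nv : 0 < `|v| by rewrite normr_gt0.
  have iu : 0 <= `|u|^-1 by rewrite invr_ge0 ltW.
  have iv : 0 <= `|v|^-1 by rewrite invr_ge0 ltW.
  have Pu' := cone_scale cP Pu iu.
  have Pv' := cone_scale cP Pv iv.
  have := hM (`|u|^-1 *: u, `|v|^-1 *: v).
  rewrite /= bZl// bZr// !normrZ !(ger0_norm iu) !(ger0_norm iv).
  rewrite mulrA -invfM mulrC ler_pdivrMr ?mulr_gt0// mulrA; apply.
  by split=> //=; rewrite normrZ ger0_norm// mulVf ?gt_eqF.
have hl : has_lbound (form_bounds P b) by exists 0 => x [].
split; last by move=> B hB; exact: ge_inf.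
split; first by apply: lb_le_inf => // x [].
move=> u v Pu Pv.
have [->|u0] := eqVneq u 0; first by rewrite b0l// !normr0 mulr0 mul0r.
have [->|v0] := eqVneq v 0; first by rewrite b0r// !normr0 mulr0.
have nuv : 0 < `|u| * `|v| by rewrite mulr_gt0 ?normr_gt0.
rewrite -mulrA -ler_pdivrMr//; apply: lb_le_inf => // B [_ hB].
by rewrite ler_pdivrMr// mulrA; exact: hB.
Qed.

(* Main.v *)
Require Import Defs.
From mathcomp Require Import all_boot zify.

Set Implicit Arguments.
Unset Strict Implicit.
Unset Printing Implicit Defensive.

(**
Put F(u) = b(u,u) + u0, r = 1 / (2|b|), and let c > 0 be the coercivity
constant. On the part of P with |u| <= r one has |F(u)| <= r/2 + |u0| < r, so
Schauder's theorem gives a fixed point in that ball. For large s, |u| = s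
implies |F(u)| >= c s^2 - |u0| > s, so F expands the shell r <= |u| <= s and has
a second fixed point of norm greater than r. In both cases the values of F lie
in a compact subset of P, which in the shell avoids 0 because b(u,u) stays away
from 0 and the cone is pointed.

Schauder's theorem is reduced to Brouwer's theorem on a simplex by a partition
of unity subordinate to a finite net. For Brouwer's theorem, label an integer
point x of the scaled simplex by an index i with g_i(x) >= x_i: Scarf's lemma
about finitely many linear orders on a finite set yields points with all the
relevant labels close to each other, hence in the limit a point with g >= x
coordinatewise, and both have coordinate sum 1.
*)

(** * Scarf's lemma *)

(* The element [d i] is a slack element for the index [i]: lowest in the order
   [i] and above every non-slack element in all the other orders. *)
Section Rooms.

Variables (I Y : finType) (rk : I -> Y -> nat) (col : Y -> I) (d : I -> Y).
Hypothesis rk_inj : forall i, injective (rk i).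
Hypothesis dK : cancel d col.
Hypothesis d_min : forall i y, rk i (d i) <= rk i y.
Hypothesis d_max :
  forall i j y, j != i -> (forall k, y != d k) -> rk i y < rk i (d j).

(** Scarf's condition: for nonempty [s], no [y] lies strictly above the minimum of [s] in all orders
    at once. *)
Definition dominant (s : {set Y}) :=
  [forall y, exists i, forall x in s, rk i y <= rk i x].

Lemma dominantP (s : {set Y}) :
  reflect (forall y, exists i, forall x, x \in s -> rk i y <= rk i x)
          (dominant s).
Proof.
apply: (iffP forallP) => h y; have := h y.
  by move/existsP=> [i /forall_inP hi]; exists i.
by move=> [i hi]; apply/existsP; exists i; apply/forall_inP.
Qed.

Lemma dominantS (s t : {set Y}) : t \subset s -> dominant s -> dominant t.
Proof.
move=> /subsetP ts /dominantP ds; apply/dominantP => y.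
by have [i hi] := ds y; exists i => x /ts; exact: hi.
Qed.

(** In an order [i] other than [i0] the lowest element [d i] is in the door, so outside elements can
    only be dominated through [i0]. This forces the added element to be the [i0]-largest one
    outside. *)
Lemma card_rooms_of_extremal_door (i0 : I) (y1 : Y) :
  (forall k, y1 != d k) ->
  #|[set y | (y \notin d @: [set~ i0]) && dominant (y |: d @: [set~ i0])]| = 1.
Proof.
move=> y1d; set t := d @: [set~ i0].
have y1t : y1 \notin t.
  by apply/imsetP => -[k _ /eqP]; apply/negP.
pose ys := [arg max_(y > y1 | y \notin t) rk i0 y].
have [yst ysmax] : ys \notin t /\ forall y, y \notin t -> rk i0 y <= rk i0 ys.
  by rewrite /ys; case: arg_maxnP => // y yt ymax; split=> // z; exact: ymax.
rewrite (_ : [set _ | _] = [set ys]) ?cards1//; apply/setP => y.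
rewrite !inE; apply/andP/eqP => [[yt /dominantP dy]|->].
  have [i hi] := dy ys; have [ei|ni] := eqVneq i i0.
    subst i; apply: (@rk_inj i0); apply/eqP; rewrite eqn_leq ysmax//=.
    by apply: hi; rewrite !inE eqxx.
  have dt : d i \in t by apply: imset_f; rewrite !inE.
  case/negP: yst; suff -> : ys = d i by [].
  apply: (@rk_inj i); apply/eqP; rewrite eqn_leq d_min andbT.
  by apply: hi; rewrite !inE dt orbT.
split=> //; apply/dominantP => z.
have [/imsetP[l _ ->]|zt] := boolP (z \in t); first by exists l => x _.
exists i0 => x; rewrite !inE => /orP[/eqP->|]; first exact: ysmax.
move=> /imsetP[j]; rewrite !inE => ji0 ->.
have [/existsP[k /eqP zk]|/existsPn zd] := boolP [exists k, z == d k].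
  have [e|ki] := eqVneq k i0; first by rewrite zk e.
  by case/negP: zt; rewrite zk; apply: imset_f; rewrite !inE.
by apply/ltnW/d_max.
Qed.

(** Every element of [t] is the minimum in some order, and [t] has one element fewer than there are
    orders, so exactly two orders share a minimum. An added element takes over one order, which must
    be one of these two since every element of [t] has to keep one; each of the two admits one
    completion. *)
Lemma card_rooms_of_door (t : {set Y}) (x0 : Y) :
  #|t|.+1 = #|I| -> dominant t -> x0 \in t -> (forall k, x0 != d k) ->
  #|[set y | (y \notin t) && dominant (y |: t)]| = 2.
Proof.
move=> ct /dominantP dt x0t x0d.
pose mn i := [arg min_(x < x0 | x \in t) rk i x].
have mnP i : mn i \in t /\ forall x, x \in t -> rk i (mn i) <= rk i x.
  by rewrite /mn; case: arg_minnP => // x xt xmin; split=> // z; exact: xmin.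
have mnt i := (mnP i).1; have mnmin i := (mnP i).2.
have mn_eq i x :
    x \in t -> (forall x', x' \in t -> rk i x <= rk i x') -> mn i = x.
  move=> xt xmin; apply: (@rk_inj i); apply/eqP.
  by rewrite eqn_leq mnmin// xmin.
have /injectivePn[i [j nij mnij]] : ~~ injectiveb mn.
  apply/negP => /injectiveP minj.
  have : #|I| <= #|t|.
    rewrite -(card_imset predT minj); apply: subset_leq_card.
    by apply/subsetP => _ /imsetP[k _ ->].
  by rewrite -ct ltnn.
have inj_but k : t \subset mn @: [set~ k] -> {in [set~ k] &, injective mn}.
  move=> tk; apply/imset_injP; apply/eqP.
  have -> : mn @: [set~ k] = t.
    by apply/eqP; rewrite eqEsubset tk andbT; apply/subsetP => _ /imsetP[l _ ->].
  by rewrite cardsC1 -ct.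
have surj x : x \in t -> exists l, mn l = x.
  by move=> xt; have [l hl] := dt x; exists l; apply: mn_eq.
pose M k := [set y | [forall l, (l != k) ==> (rk l (mn l) < rk l y)]].
have MP k y : reflect (forall l, l != k -> rk l (mn l) < rk l y) (y \in M k).
  rewrite inE; apply: (iffP forallP) => h l.
    by move=> lk; have /implyP := h l; apply.
  by apply/implyP; exact: h.
(* [M k] consists of the elements that can be added to [t] without becoming the
   minimum in any order but [k]; its [k]-largest element completes [t] to a room. *)
have key k m : m != k -> mn k = mn m -> exists y,
   [/\ y \notin t, dominant (y |: t), y \in M k &
     forall z, z \notin t -> dominant (z |: t) -> z \in M k -> z = y].
  move=> mk mnkm.
  (* The non-slack [x0] enters here: in every order but [k] the minimum is at most [x0], which lies
     below [d k]. *)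
  have dkM : d k \in M k.
    have dkt : d k \notin t.
      apply/negP => dkt.
      have e : mn k = d k by apply: mn_eq => // x _.
      have := mnmin m x0 x0t; rewrite -mnkm e leqNgt => /negP; apply.
      by apply: d_max => //; rewrite eq_sym.
    apply/MP => l lk; rewrite (leq_ltn_trans (mnmin l x0 x0t))//.
    by apply: d_max => //; rewrite eq_sym.
  pose y := [arg max_(y > d k | y \in M k) rk k y].
  have [yM ymax] : y \in M k /\ forall z, z \in M k -> rk k z <= rk k y.
    by rewrite /y; case: arg_maxnP => // z zM zmax; split=> // w; exact: zmax.
  exists y; split => //.
  - apply/negP => yt; have [l ml] := surj y yt.
    have [lk|lk] := eqVneq l k.
      have /MP/(_ m mk) := yM; rewrite -mnkm -lk ml ltnn//.
    by have /MP/(_ l lk) := yM; rewrite ml ltnn.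
  - apply/dominantP => z.
    have [zM|] := boolP (z \in M k).
      exists k => x; rewrite !inE => /orP[/eqP->|xt]; first exact: ymax.
      have [l hl] := dt z.
      have [<-|lk] := eqVneq l k; first exact: hl.
      by have /MP/(_ l lk) := zM; rewrite ltnNge hl.
    rewrite inE negb_forall => /existsP[l]; rewrite negb_imply -leqNgt => /andP[lk zl].
    exists l => x; rewrite !inE => /orP[/eqP->|xt].
      by apply: leq_trans zl (ltnW _); have /MP := yM; apply.
    exact: leq_trans zl (mnmin _ _ xt).
  - move=> z zt /dominantP dz zM.
    have [l hl] := dz y; have [e|lk] := eqVneq l k.
      apply: (@rk_inj k); apply/eqP; rewrite eqn_leq ymax//= -e.
      by apply: hl; rewrite !inE eqxx.
    have /MP/(_ l lk) := yM; rewrite ltnNge => /negP[].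
    by apply: hl; rewrite !inE mnt orbT.
have nji : j != i by rewrite eq_sym.
have [yi [yit dyi yiM yiu]] := key i j nji mnij.
have [yj [yjt dyj yjM yju]] := key j i nij (esym mnij).
(* A common element of [M i] and [M j] would exceed the minimum of [t] in every order, against
   dominance. *)
have nyij : yi != yj.
  apply/eqP => e; have [l hl] := dt yi.
  have [li|li] := eqVneq l i; last first.
    by have /MP/(_ l li) := yiM; rewrite ltnNge hl.
  have lj : l != j by rewrite li.
  by have /MP/(_ l lj) := yjM; rewrite -e ltnNge hl.
rewrite (_ : [set _ | _] = [set yi; yj]) ?cards2 ?nyij//.
apply/setP => y; rewrite !inE; apply/andP/orP; last first.
  by move=> [/eqP->|/eqP->].
move=> [yt dy].
have /dominantP dy' := dy.
have [k hk] := dy' y.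
have lt_mn l : (forall x, x \in y |: t -> rk l y <= rk l x) ->
    forall x, x \in t -> rk l y < rk l x.
  move=> hl x xt; rewrite ltn_neqAle hl ?inE ?xt ?orbT// andbT.
  by apply/eqP => /rk_inj e; move: yt; rewrite e xt.
have min_other x l : x \in t -> mn l = x -> rk l y <= rk l (mn l) -> l != k ->
    exists2 m, m != k & m != l /\ mn m = x.
  move=> xt ml yl lk; have [m hm] := dy' x; exists m.
    apply/eqP => e; have := lt_mn k hk x xt; rewrite ltnNge.
    by rewrite -e hm// !inE eqxx.
  split; last by apply: mn_eq => // x' x't; apply: hm; rewrite !inE x't orbT.
  apply/eqP => e; have := hm y; rewrite e !inE eqxx => /(_ isT) => xy.
  have : rk l x = rk l y by apply/eqP; rewrite eqn_leq xy -ml yl.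
  by move/rk_inj => e'; move: yt; rewrite -e' xt.
have tk : t \subset mn @: [set~ k].
  apply/subsetP => x xt; have [m hm] := dy' x.
  apply/imsetP; exists m; last first.
    by apply/esym/mn_eq => // x' x't; apply: hm; rewrite !inE x't orbT.
  rewrite !inE; apply/eqP => e.
  have := lt_mn k hk x xt; rewrite ltnNge -e hm// !inE eqxx//.
have minj := inj_but k tk.
(* If [y] also fell below [mn l], that element would need a further order to stay a minimum, against
   injectivity of [mn] off [k]. *)
have yM : y \in M k.
  apply/MP => l lk; rewrite ltnNge; apply/negP => yl.
  have [m mk [ml mm]] := min_other _ l (mnt l) erefl yl lk.
  by case/negP: ml; apply/eqP; apply: minj; rewrite ?inE.
have [ki|ki] := eqVneq k i; first by left; apply/eqP/yiu => //; rewrite -ki.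
have [kj|kj] := eqVneq k j; first by right; apply/eqP/yju => //; rewrite -kj.
by case/negP: nij; apply/eqP; apply: minj; rewrite ?inE// eq_sym.
Qed.

(** If removing [x] leaves each color other than [i0] exactly once, then [x] shares its color with a
    single [x'], as [s] misses [i0]. Removing [x'] works equally; removing anything else leaves a
    repeated color. *)
Lemma even_doors_of_room (i0 : I) (s : {set Y}) :
  #|s| = #|I| -> col @: s != setT ->
  ~~ odd #|[set x in s | col @: (s :\ x) == [set~ i0]]|.
Proof.
move=> cs ncol.
have [->|/set0Pn[x]] := eqVneq [set x in s | col @: (s :\ x) == [set~ i0]] set0.
  by rewrite cards0.
set D := [set x in s | _].
rewrite inE => /andP[xs /eqP cx].
have D_inj z : z \in D -> {in s :\ z &, injective col}.
  rewrite inE => /andP[zs /eqP cz]; apply/imset_injP.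
  by rewrite cz cardsC1 -cs (cardsD1 z s) zs.
have xD : x \in D by rewrite inE xs cx eqxx.
have colx : col x \in [set~ i0].
  rewrite !inE; apply: contra ncol => /eqP e; apply/eqP/setP => i.
  rewrite inE; have [->|ii0] := eqVneq i i0.
    by rewrite -e; apply/imset_f.
  have : i \in [set~ i0] by rewrite !inE.
  rewrite -cx => /imsetP[z]; rewrite inE => /andP[_ zs] ->.
  exact: imset_f.
have := colx; rewrite -cx => /imsetP[x']; rewrite !inE => /andP[x'x x's] colxx'.
rewrite (_ : D = [set x; x']) ?cards2 1?eq_sym ?x'x//.
apply/setP => z; rewrite in_set2; apply/idP/orP; last first.
  move=> [/eqP->//|/eqP->]; rewrite inE x's /= -cx; apply/eqP.
  have e1 : s :\ x' = x |: (s :\ x :\ x').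
    apply/setP => w; rewrite !inE; have [->|] := eqVneq w x => //=.
    by rewrite eq_sym x'x xs.
  have e2 : s :\ x = x' |: (s :\ x :\ x').
    by apply/esym/setD1K; rewrite !inE x'x.
  by rewrite e1 [in RHS]e2 !imsetU1 colxx'.
move=> zD; have [|zx] := eqVneq z x; first by left.
have [|zx'] := eqVneq z x'; first by right.
case/negP: x'x; apply/eqP; apply: (D_inj z zD) => //.
- by rewrite !inE eq_sym zx' x's.
- by rewrite !inE eq_sym zx xs.
Qed.

(* Double counting, mod 2, of the pairs t < s where s is a room (dominant, with
   #|I| elements) and t is a door (dominant, one element fewer, carrying every
   color but [i0]): a door lies in two rooms, except the door made of the slack
   elements alone, which lies in one; a room that misses a color has an even
   number of doors. *)
Lemma rainbow_room (y1 : Y) : (forall k, y1 != d k) ->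
  exists s : {set Y}, [/\ #|s| = #|I|, dominant s & col @: s = setT].
Proof.
move=> y1d; pose i0 := col y1.
have I0 : #|[set~ i0]|.+1 = #|I|.
  by rewrite cardsC1 prednK//; apply/card_gt0P; exists i0.
pose room (s : {set Y}) := (#|s| == #|I|) && dominant s.
pose door (t : {set Y}) :=
  [&& #|t|.+1 == #|I|, dominant t & col @: t == [set~ i0]].
pose up (t : {set Y}) := [set y | (y \notin t) && dominant (y |: t)].
pose down (s : {set Y}) := [set x in s | col @: (s :\ x) == [set~ i0]].
have [|/existsPn no] :=
    boolP [exists s : {set Y}, room s && (col @: s == setT)].
  by move=> /existsP[s /andP[/andP[/eqP ? ?] /eqP ?]]; exists s.
have count_up t : door t -> #|[set s | room s && (t \subset s)]| = #|up t|.
  move=> /and3P[/eqP ct dt _].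
  rewrite -(@card_in_imset _ _ (fun y => y |: t) (up t)); last first.
    move=> y z; rewrite !inE => /andP[yt _] /andP[zt _] e.
    have : y \in z |: t by rewrite -e !inE eqxx.
    by rewrite !inE (negbTE yt) orbF => /eqP.
  congr #|pred_of_set _|; apply/setP => s; rewrite inE; apply/andP/imsetP.
    move=> [/andP[/eqP cs ds] ts].
    have /set0Pn[y ys] : s :\: t != set0.
      rewrite -card_gt0 cardsD (setIidPr ts) subn_gt0 cs -ct//.
    have [yt ys'] : y \notin t /\ y \in s by move: ys; rewrite inE => /andP.
    have e : y |: t = s.
      apply/eqP; rewrite eqEcard subUset sub1set ys' ts /= cardsU1 yt add1n.
      by rewrite cs ct.
    by exists y => //; rewrite inE yt e.
  move=> [y]; rewrite inE => /andP[yt dy] ->; split; last exact: subsetUr.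
  by rewrite /room dy cardsU1 yt add1n ct eqxx.
have count_down s : room s -> #|[set t | door t && (t \subset s)]| = #|down s|.
  move=> /andP[/eqP cs ds].
  rewrite -(@card_in_imset _ _ (fun y => s :\ y) (down s)); last first.
    move=> y z; rewrite !inE => /andP[ys _] /andP[zs _] e.
    apply/eqP; rewrite -[_ == _]negbK; apply/negP => yz.
    have : y \in s :\ z by rewrite !inE yz.
    by rewrite -e !inE eqxx.
  congr #|pred_of_set _|; apply/setP => t; rewrite inE; apply/andP/imsetP.
    move=> [/and3P[/eqP ct dt col_t] ts].
    have /set0Pn[y ys] : s :\: t != set0.
      rewrite -card_gt0 cardsD (setIidPr ts) subn_gt0 cs -ct//.
    have [yt ys'] : y \notin t /\ y \in s by move: ys; rewrite inE => /andP.
    have e : t = s :\ y.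
      apply/eqP; rewrite eqEcard subsetD1 ts yt /=.
      by have := cardsD1 y s; rewrite ys' add1n cs -ct => -[->].
    by exists y => //; rewrite inE ys' -e.
  move=> [y]; rewrite inE => /andP[ys cy] ->; split; last exact: subD1set.
  rewrite /door cy (dominantS _ ds) ?subD1set// !andbT.
  by rewrite -cs (cardsD1 y s) ys.
have : \sum_(t | door t) #|[set s | room s && (t \subset s)]| =
       \sum_(s | room s) #|[set t | door t && (t \subset s)]|.
  under eq_bigr do rewrite -sum1_card.
  under [RHS]eq_bigr do rewrite -sum1_card.
  rewrite (exchange_big_dep room)/=; last by move=> t s _; rewrite inE => /andP[].
  apply: eq_bigr => s rs; apply: eq_bigl => t.
  by rewrite !inE rs.
move=> /(congr1 odd).
rewrite [in RHS](big_morph odd oddD (erefl _)) [in RHS]big1; last first.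
  move=> s rs; rewrite count_down//; apply/negbTE/even_doors_of_room.
    by case/andP: rs => /eqP.
  by have := no s; rewrite rs.
have dt0 : door (d @: [set~ i0]).
  rewrite /door card_imset ?I0 ?eqxx /=; last exact: can_inj dK.
  apply/andP; split; last first.
    rewrite -imset_comp; apply/eqP; rewrite -[RHS]imset_id.
    by apply: eq_imset => x /=; rewrite dK.
  have /eqP := card_rooms_of_extremal_door i0 y1d.
  move=> /cards1P[y] /setP /(_ y); rewrite !inE eqxx => /andP[_ dy].
  by apply: dominantS dy; exact: subsetUr.
rewrite (big_morph odd oddD (erefl _)) (bigD1 _ dt0)/= count_up//.
rewrite (card_rooms_of_extremal_door i0 y1d) big1// => t /andP[dt nt].
rewrite count_up// (_ : #|_| = 2)//.
case/and3P: dt => /eqP ct dt /eqP col_t.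
have [/existsP[x /andP[xt /forallP xd]]|/existsPn td] :=
  boolP [exists x, (x \in t) && [forall k, x != d k]].
  exact: card_rooms_of_door xt xd.
(* A door made of slack elements only is determined by its colors, so it is the extremal one. *)
case/negP: nt; apply/eqP/eqP; rewrite eqEcard card_imset; last exact: can_inj dK.
rewrite -ltnS ct I0 leqnn andbT; apply/subsetP => x xt.
have := td x; rewrite xt /= => /forallPn[k]; rewrite negbK => /eqP xk.
rewrite xk; apply: imset_f; rewrite -col_t; apply/imsetP; exists x => //.
by rewrite xk dK.
Qed.

End Rooms.

(** Slack elements [inr i] are adjoined to [T]. The order [i] dominating [inl y] in a rainbow room
    cannot have its color carried by [inr i], whose rank is 0, so that color comes from a point of
    [T]. *)
Lemma scarf (I T : finType) (r : I -> T -> nat) (c : T -> I) (x0 : T) :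
  (forall i, injective (r i)) ->
  exists2 A : {set T}, A != set0 &
    forall y, exists2 i, i \in c @: A & forall x, x \in A -> r i y <= r i x.
Proof.
move=> r_inj.
pose B i := \max_x r i x.
have rB i x : r i x <= B i by exact: leq_bigmax.
(* The successor reserves rank 0 for [inr i]; the other slack elements go above all of [T], kept
   distinct by [enum_rank]. *)
pose rk i (y : T + I) : nat := match y with
  | inl x => (r i x).+1
  | inr j => if j == i then 0 else (B i + enum_rank j).+2 end.
pose col (y : T + I) := match y with inl x => c x | inr j => j end.
have rk_inj i : injective (rk i).
  move=> [x|j] [y|k] /=.
  - by move=> [/r_inj->].
  - by case: ifP => // _ e; have := rB i x; lia.
  - by case: ifP => // _ e; have := rB i y; lia.
  - case: eqVneq => [->|_]; case: eqVneq => [->|_]// [] /addnI.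
    by move=> /ord_inj/enum_rank_inj->.
have colK : cancel (@inr T I) col by [].
have d_min i y : rk i (inr i) <= rk i y by rewrite /= eqxx.
have d_max i j (y : T + I) :
    j != i -> (forall k, y != inr k) -> rk i y < rk i (inr j).
  case: y => [x|k]; last by move=> _ /(_ k); rewrite eqxx.
  by move=> /negbTE/= -> _; rewrite !ltnS (leq_trans (rB i x))// ?leq_addr.
have [//|s [cs /dominantP ds cols]] :=
  rainbow_room rk_inj colK d_min d_max (y1 := inl x0).
have col_inj : {in s &, injective col}.
  by apply/imset_injP; rewrite cols cs cardsT.
pose A := [set x | inl x \in s].
have main y : exists2 i, i \in c @: A & forall x, x \in A -> r i y <= r i x.
  have [i hi] := ds (inl y).
  have : i \in col @: s by rewrite cols inE.
  move=> /imsetP[[x|j] xs /= e]; last by have := hi _ xs; rewrite /= e eqxx.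
  exists i; first by rewrite e; apply/imsetP; exists x => //; rewrite inE.
  by move=> x'; rewrite inE => /hi.
exists A => //.
have [i /imsetP[x xA _] _] := main x0.
by apply/set0Pn; exists x.
Qed.

(* If [A] is dominant for its own colors C, the coordinatewise minima m over
   [A] satisfy sum_(i in C) (m i + 1) > N, since otherwise an integer point
   would exceed m in every coordinate of C. Hence the points of [A] are within
   #|I| of each other. *)
Lemma integer_simplex_labeling (I : finType) (N : nat)
    (c : {ffun I -> 'I_N.+1} -> I) :
  exists2 a : {ffun I -> 'I_N.+1}, \sum_i a i = N &
  forall i, exists x : {ffun I -> 'I_N.+1},
    [/\ \sum_i x i = N,
        forall j, x j <= a j + #|I| /\ a j <= x j + #|I| &
        c x = i \/ x i <= #|I|].
Proof.
pose T : finType := {x : {ffun I -> 'I_N.+1} | \sum_i x i == N}.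
have mkT (y : I -> nat) :
    \sum_i y i = N -> exists x : T, forall i, val x i = y i :> nat.
  move=> sy; have yN i : y i < N.+1.
    by rewrite ltnS -sy (bigD1 i)//= leq_addr.
  have sx : \sum_i [ffun i => Ordinal (yN i)] i == N.
    by rewrite -[X in _ == X]sy; apply/eqP; apply: eq_bigr => i _; rewrite ffunE.
  exists (exist (fun x : {ffun I -> 'I_N.+1} => \sum_i x i == N) _ sx) => i /=.
  by rewrite ffunE.
pose i1 := c [ffun=> ord0].
have [x0 _] : exists x : T, forall i, val x i = (if i == i1 then N else 0) :> nat.
  by apply: mkT; rewrite -big_mkcond/= big_pred1_eq.
(* the rank of [x] breaks the ties between points with equal coordinates *)
pose r i (x : T) := val x i * #|T| + enum_rank x.
have T0 : 0 < #|T| by apply/card_gt0P; exists x0.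
have r_inj i : injective (r i).
  move=> x y /(congr1 (modn^~ #|T|)); rewrite /r !modnMDl !modn_small//.
  by move=> /ord_inj/enum_rank_inj.
have r_lt i (x y : T) : r i x <= r i y -> val x i <= val y i.
  rewrite /r leqNgt => h; rewrite leqNgt; apply: contra h => h.
  have := leq_mul h (leqnn #|T|); have := ltn_ord (enum_rank y);
  rewrite mulSn => h1 h2.
  apply: leq_trans (leq_addr _ _); apply: leq_trans h2.
  by rewrite -addnS addnC leq_add2r.
have [A /set0Pn[a aA] domA] := scarf (c \o val) x0 r_inj.
pose C := (c \o val) @: A.
(* Outside [C] the value 0 is still a lower bound for the coordinates. *)
pose m i := if i \in C then val [arg min_(x < a | x \in A) val x i] i : nat else 0.
have mA i x : x \in A -> m i <= val x i.
  by rewrite /m; case: ifP => // _ xA; case: arg_minnP => // z _; exact.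
have mC i : i \in C -> exists2 x, x \in A & m i = val x i.
  by rewrite /m => ->; case: arg_minnP => // z zA _; exists z.
have sC : N < \sum_(i in C) (m i).+1.
  rewrite ltnNge; apply/negP => sN.
  have [i2 i2C _] := domA a.
  (* [rest] goes to the coordinate [i2] to bring the sum of [y] to exactly [N]. *)
  pose rest := N - \sum_(i in C) (m i).+1.
  pose y i := if i \in C then (m i).+1 + (if i == i2 then rest else 0) else 0.
  have [|z zy] := mkT y.
    rewrite -big_mkcond/= big_split/= -big_mkcondr/=.
    rewrite [X in _ + X](bigD1 i2)/= ?i2C ?eqxx//=.
    rewrite [X in _ + (_ + X)]big1 ?addn0; first by rewrite subnKC.
    by move=> j /andP[/andP[_ /eqP ->]]; rewrite eqxx.
  have [i iC hi] := domA z.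
  have [x xA mx] := mC i iC.
  have := r_lt _ _ _ (hi x xA); rewrite zy /y iC -mx; lia.
have sm : N < \sum_i m i + #|I|.
  apply: leq_trans sC _; rewrite -sum1_card -big_split/=.
  rewrite [X in X <= _]big_mkcond/=; apply: leq_sum => i _.
  by case: ifP => // _; rewrite addn1.
have mle x i : x \in A -> val x i < m i + #|I|.
  move=> xA; have /eqP := valP x => sx.
  have : \sum_(j | j != i) m j <= \sum_(j | j != i) val x j.
    by apply: leq_sum => j _; exact: mA.
  move: sx sm; rewrite (bigD1 i)//= [in X in _ -> X](bigD1 i)//=; lia.
have close x j : x \in A ->
    val x j <= val a j + #|I| /\ val a j <= val x j + #|I|.
  move=> xA; have := mle _ j aA; have := mle _ j xA.
  by have := mA j _ aA; have := mA j _ xA; lia.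
exists (val a); first exact/eqP/(valP a).
move=> i; have [/imsetP[x xA e]|iC] := boolP (i \in C).
  exists (val x); split; [exact/eqP/(valP x)|by move=> j; exact: close|].
  by left; rewrite e.
exists (val a); split; [exact/eqP/(valP a)|by move=> j; exact: close|].
right; have := mle _ i aA; rewrite /m (negbTE iC); lia.
Qed.

From mathcomp Require Import all_order all_algebra.
From mathcomp Require Import all_classical all_reals all_analysis.
From mathcomp Require Import finmap ring lra.

Import Order.TTheory GRing.Theory Num.Theory.
Import numFieldNormedType.Exports.

Local Open Scope classical_set_scope.
Local Open Scope ring_scope.

(** * The theorems of Brouwer and Schauder *)

Lemma within_continuousP (R : realType) (V W : normedModType R) (A : set V)
    (f : V -> W) :
  {within A, continuous f} <->
  forall x, A x -> forall e : R, 0 < e -> exists2 d : R, 0 < d &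
    forall y, A y -> `|x - y| < d -> `|f x - f y| < e.
Proof.
rewrite subspace_continuousP; split=> h x Ax.
  move=> e e0; have /cvgrPdist_lt/(_ e e0) := h x Ax.
  rewrite /prop_near1 /within/= => /nbhs_ballP[d /= d0 hd]; exists d => //.
  by move=> y Ay xy; apply: hd => //; rewrite -ball_normE.
apply/cvgrPdist_lt => e e0; have [d d0 hd] := h x Ax e e0.
rewrite /prop_near1 /within/=; apply/nbhs_ballP; exists d => //= y.
by rewrite -ball_normE /= => xy Ay; exact: hd.
Qed.

Lemma compact_seq_cluster (R : realType) (V : normedModType R) (K : set V)
    (u : nat -> V) :
  compact K -> (forall n, K (u n)) ->
  exists2 p, K p &
    forall (e : R) N, 0 < e -> exists2 n, (N <= n)%N & `|p - u n| < e.
Proof.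
move=> cK Ku; have [|p [Kp up]] := cK (u @ \oo) _.
  by exists 0%N => // n _; exact: Ku.
exists p => // e N e0.
have [|_ [[n /= Nn <-] pn]] :=
    up (u @` [set n | (N <= n)%N]) (ball p e) _ (nbhsx_ballx _ _ e0).
  by exists N => // n Nn; exists n.
by exists n => //; move: pn; rewrite -ball_normE.
Qed.

Lemma inv_nat_small (R : realType) (a e : R) : 0 <= a -> 0 < e ->
  exists N, forall n, (N <= n)%N -> a / n.+1%:R < e.
Proof.
move=> a0 e0; exists (Num.bound (a / e)) => n Nn.
have h : a / e < n.+1%:R.
  apply: lt_le_trans (archi_boundP _) _; first by rewrite divr_ge0// ltW.
  by rewrite ler_nat (leq_trans Nn).
by rewrite ltr_pdivrMr// mulrC -ltr_pdivrMr.
Qed.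

Lemma entry_le_norm (R : realType) n (v : 'rV[R]_n) i : `|v 0 i| <= `|v|.
Proof.
rewrite [leRHS]/Num.norm/= mx_normrE.
by apply/bigmax_geP; right; exists (0, i).
Qed.

Lemma norm_row_lt (R : realType) n (v : 'rV[R]_n) e : 0 < e ->
  (forall i, `|v 0 i| < e) -> `|v| < e.
Proof.
move=> e0 h; rewrite [ltLHS]/Num.norm/= mx_normrE.
by apply/bigmax_ltP; split=> // -[i j] _ /=; rewrite (ord1 i).
Qed.

Definition std_simplex (R : realType) n : set 'rV[R]_n :=
  [set x | (forall i, 0 <= x 0 i) /\ \sum_i x 0 i = 1].

Lemma std_simplex_le1 (R : realType) n (x : 'rV[R]_n) i :
  std_simplex x -> x 0 i <= 1.
Proof. by move=> [x0 <-]; rewrite (bigD1 i)//= lerDl sumr_ge0. Qed.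

Lemma compact_std_simplex (R : realType) n : compact (@std_simplex R n).
Proof.
apply: bounded_closed_compact.
  exists 1; split=> // M M1 x sx; apply/ltW/norm_row_lt.
    by rewrite (lt_trans _ M1).
  by move=> i; rewrite ger0_norm ?(le_lt_trans (std_simplex_le1 i sx))//; case: sx.
rewrite (_ : @std_simplex R n = (\bigcap_i [set x : 'rV[R]_n | 0 <= x 0 i]) `&`
    (fun x : 'rV[R]_n => \sum_i x 0 i) @^-1` [set 1]); last first.
  apply/seteqP; split=> x [x0 x1]; split=> // i; last exact: (x0 i I).
  by move=> _; exact: x0.
apply: closedI.
  apply: closed_bigI => i _.
  apply: (@preimage_closed _ _ (fun x : 'rV[R]_n => x 0 i) [set y | 0 <= y]).
    by move=> x _; exact: coord_continuous.
  exact: closed_ge.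
apply: preimage_closed; last exact: closed_eq.
move=> x _; apply: (@continuous_big _ _ +%R 0 xpredT) => [z|i _].
  exact: add_continuous.
exact: coord_continuous.
Qed.

Lemma brouwer_simplex (R : realType) n (g : 'rV[R]_n.+1 -> 'rV[R]_n.+1) :
  (forall x, std_simplex x -> std_simplex (g x)) ->
  {within @std_simplex R n.+1, continuous g} ->
  exists2 x, std_simplex x & g x = x.
Proof.
move=> gS /within_continuousP gc.
pose pt N (k : {ffun 'I_n.+1 -> 'I_N.+2}) : 'rV[R]_n.+1 :=
  \row_i ((k i)%:R / N.+1%:R).
have ptS N (k : {ffun 'I_n.+1 -> 'I_N.+2}) :
    (\sum_i k i)%N = N.+1 -> std_simplex (pt N k).
  move=> sk; split=> [i|]; first by rewrite mxE divr_ge0.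
  under eq_bigr do rewrite mxE.
  by rewrite -mulr_suml -natr_sum sk divff// pnatr_eq0.
have exi (x : 'rV[R]_n.+1) : std_simplex x -> exists i, x 0 i <= g x 0 i.
  move=> sx; apply/existsP; rewrite -[X in is_true X]negbK; apply/negP => /existsPn h.
  have [_ s1] := sx; have [_ s2] := gS _ sx.
  have : \sum_i g x 0 i < \sum_i x 0 i.
    apply: ltr_sum => [|i _]; last by rewrite ltNge h.
    by apply/hasP; exists ord0; rewrite ?mem_index_enum.
  by rewrite s1 s2 ltxx.
(* By [exi] the search succeeds at every grid point of the simplex; the default [ord0] only concerns
   other [k]. *)
pose c N k := odflt ord0 [pick i | pt N k 0 i <= g (pt N k) 0 i].
have cP N (k : {ffun 'I_n.+1 -> 'I_N.+2}) : (\sum_i k i)%N = N.+1 ->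
    pt N k 0 (c N k) <= g (pt N k) 0 (c N k).
  move=> sk; rewrite /c; case: pickP => //= h.
  by have [i] := exi _ (ptS _ _ sk); rewrite h.
(* The distance [#|I|] becomes [n.+1 / N.+1] after scaling. Either [i] is the label of [x], or
   [x 0 i] is itself at most this error while [g x 0 i] is nonnegative. *)
have ex_u (N : nat) : exists u : 'rV[R]_n.+1, std_simplex u /\
  forall i, exists x, [/\ std_simplex x,
    forall j, `|u 0 j - x 0 j| <= n.+1%:R / N.+1%:R &
    x 0 i <= g x 0 i + n.+1%:R / N.+1%:R].
  have [a sa ha] := integer_simplex_labeling (c N).
  exists (pt N a); split=> [|i]; first exact: ptS.
  have [x [sx cl lab]] := ha i.
  rewrite card_ord in cl lab.
  exists (pt N x); split; [exact: ptS| |].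
    move=> j; rewrite !mxE -mulrBl normrM (@ger0_norm _ (_^-1)) ?invr_ge0//.
    rewrite ler_pM2r ?invr_gt0// ler_norml; have := cl j.
    by rewrite -!(ler_nat R) !natrD => -[? ?]; lra.
  case: lab => [<-|h].
    by apply: le_trans (cP _ _ sx) _; rewrite lerDl divr_ge0.
  rewrite mxE; apply: ler_wpDl; first by have [+ _] := gS _ (ptS _ _ sx); apply.
  by rewrite ler_pM2r ?invr_gt0// ler_nat.
have [u hu] := choice ex_u.
have [p pS pu] :=
  compact_seq_cluster (@compact_std_simplex R n.+1) (fun N => (hu N).1).
exists p => //.
have le_g i : p 0 i <= g p 0 i.
  rewrite leNgt; apply/negP => lt_g.
  (* Going from [p 0 i] to [x 0 i], [g x 0 i] and [g p 0 i] loses less than [e] each time, so a gap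
     of [4 * e] is impossible. *)
  pose e := (p 0 i - g p 0 i) / 4.
  have e0 : 0 < e by rewrite divr_gt0// subr_gt0.
  have [d d0 hd] := gc p pS e e0.
  pose d' := Num.min d e / 2.
  have d'0 : 0 < d' by rewrite divr_gt0// lt_min d0.
  have [N0 hN0] := @inv_nat_small R n.+1%:R d' (ler0n _ _) d'0.
  have [N NN0 pN] := pu d' N0 d'0.
  have nN := hN0 N NN0.
  have [_ /(_ i)[x [xS xa xg]]] := hu N.
  have px : `|p - x| < Num.min d e.
    have -> : p - x = (p - u N) + (u N - x) by rewrite addrA subrK.
    apply: le_lt_trans (ler_normD _ _) _.
    rewrite (splitr (Num.min d e)) ltrD//.
    apply: norm_row_lt => // j; apply: le_lt_trans nN.
    by rewrite !mxE; exact: xa.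
  have [pd pe] : `|p - x| < d /\ `|p - x| < e by move: px; rewrite lt_min => /andP.
  have gx := hd x xS pd.
  have h1 := le_lt_trans (entry_le_norm (p - x) i) pe.
  have h2 := le_lt_trans (entry_le_norm (g p - g x) i) gx.
  have h3 : n.+1%:R / N.+1%:R < e.
    have : Num.min d e <= e by rewrite ge_min lexx orbT.
    by move=> ?; apply: lt_trans nN _; rewrite /d'; lra.
  move: h1 h2; rewrite !mxE !ltr_norml => /andP[_ +] /andP[+ _].
  have : e * 4 = p 0 i - g p 0 i by rewrite /e divfK.
  move: xg h3; clearbody e.
  move: (p 0 i) (g p 0 i) (x 0 i) (g x 0 i) (n.+1%:R / N.+1%:R) => p0 p1 x0 x1 q.
  lra.
have [_ s1] := pS; have [_ s2] := gS _ pS.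
have s0 : \sum_i (g p 0 i - p 0 i) = 0 by rewrite sumrB s1 s2 subrr.
apply/rowP => i; apply/eqP; rewrite -subr_eq0; apply/eqP.
by apply: (psumr_eq0P _ s0) => // j _; rewrite subr_ge0.
Qed.

(** * Convexity, finite nets and Schauder's theorem *)

Lemma convex_setP (R : realType) (E : lmodType R) (D : set E) :
  convex_set D <-> forall (x y : E) (t : R), D x -> D y -> 0 <= t -> t <= 1 ->
    D (t *: x + (1 - t) *: y).
Proof.
split=> [cD x y t /mem_set Dx /mem_set Dy t0 t1|h x y t]; last first.
  by move=> /set_mem Dx /set_mem Dy; apply: mem_set; exact: h.
have t01 : Itv.spec (@Itv.num_sem R) (Itv.Real `[0, 1]%Z) t.
  by rewrite /= /Itv.num_sem/= realE t0/= in_itv/= t0 t1.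
exact: set_mem (cD _ _ (Itv.mk t01) Dx Dy).
Qed.

Lemma convex_set_sum (R : realType) (E : lmodType R) (D : set E) n
    (l : 'I_n -> R) (y : 'I_n -> E) :
  convex_set D -> (forall i, D (y i)) -> (forall i, 0 <= l i) ->
  \sum_i l i = 1 -> D (\sum_i l i *: y i).
Proof.
move=> cD; elim: n l y => [|n IH] l y Dy l0 l1.
  by move: l1; rewrite big_ord0 => /eqP; rewrite eq_sym oner_eq0.
(* The other weights are renormalized by [1 - l ord0], so its vanishing is treated apart. *)
have [e|ne] := eqVneq (l ord0) 1.
  have l0' i : l (lift ord0 i) = 0.
    move: l1; rewrite big_ord_recl e -[RHS]addr0 => /addrI l1.
    by apply: (psumr_eq0P _ l1).
  rewrite big_ord_recl e scale1r big1 ?addr0// => i _.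
  by rewrite l0' scale0r.
have s1 : \sum_i l (lift ord0 i) = 1 - l ord0.
  by rewrite -l1 big_ord_recl addrC addKr.
have s0 : 0 < 1 - l ord0.
  by rewrite lt_neqAle eq_sym subr_eq0 eq_sym ne/= -s1 sumr_ge0.
rewrite big_ord_recl.
have -> : \sum_i l (lift ord0 i) *: y (lift ord0 i) = (1 - l ord0) *:
    \sum_i (l (lift ord0 i) / (1 - l ord0)) *: y (lift ord0 i).
  rewrite scaler_sumr; apply: eq_bigr => i _.
  by rewrite scalerA mulrC divfK// gt_eqF.
apply: (convex_setP D).1 => //; last by rewrite -subr_ge0 ltW.
apply: IH => //; first by move=> i; rewrite divr_ge0// ltW.
by rewrite -mulr_suml s1 divff// gt_eqF.
Qed.

Lemma compact_net (R : realType) (E : normedModType R) (K : set E) (e : R) :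
  compact K -> K !=set0 -> 0 < e ->
  exists n (y : 'I_n.+1 -> E),
    (forall i, K (y i)) /\ forall z, K z -> exists i, `|y i - z| < e.
Proof.
rewrite compact_cover => cK [x0 Kx0] e0.
have [|z Kz|F FK KF] := cK E K (fun x => ball x e).
- by move=> x _; exact: ball_open.
- by exists z => //; exact: ballxx.
have [y0 /= y0F _] := KF x0 Kx0.
pose n := size (enum_fset F).
have n0 : (0 < n)%N by rewrite /n -has_predT; apply/hasP; exists y0.
exists n.-1, (fun i => nth y0 (enum_fset F) i); split.
  move=> i; have : nth y0 (enum_fset F) i \in F.
    by apply: mem_nth; exact: leq_trans (ltn_ord i) (eq_leq (prednK n0)).
  by move=> /FK/set_mem.
move=> z Kz; have [y /= yF] := KF z Kz; rewrite -ball_normE /= => yz.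
have iy : (index y (enum_fset F) < n.-1.+1)%N by rewrite prednK// index_mem.
by exists (Ordinal iy); rewrite /= nth_index.
Qed.

Lemma cvg_rowP (R : realType) (T : Type) (F : set_system T) n
    (f : T -> 'rV[R]_n) (l : 'rV[R]_n) : Filter F ->
  (forall i, f x 0 i @[x --> F] --> l 0 i) -> f @ F --> l.
Proof.
move=> FF h; apply/cvgrPdist_lt => e e0.
have : forall i, \forall x \near F, `|l 0 i - f x 0 i| < e.
  by move=> i; have /cvgrPdist_lt := h i; apply.
move=> /filter_forall; apply: filterS => x hx; apply: norm_row_lt => // i.
by rewrite !mxE.
Qed.

Lemma cvg_into_within (T U : Type) (F : set_system T) (G : set_system U)
    (D : set U) (f : T -> U) : Filter F ->
  f @ F --> G -> (\forall x \near F, D (f x)) -> f @ F --> within D G.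
Proof. by move=> FF fG fD A /fG; apply: filterS2 fD => x Dx; exact. Qed.

(** The Schauder projection: [X] maps weights to combinations of net points, and [g] sends [l] to
    the normalized weights of [f (X l)]. At a Brouwer fixed point [l], [X l] averages only net
    points closer than [e] to [f (X l)]. *)
Lemma schauder_approx (R : realType) (E : normedModType R) (D K : set E)
    (f : E -> E) (e : R) :
  convex_set D -> compact K -> K !=set0 -> K `<=` D ->
  {within D, continuous f} -> (forall x, D x -> K (f x)) -> 0 < e ->
  exists2 x, D x & `|x - f x| < e.
Proof.
move=> cD cK K0 KD fc fK e0.
have [n [y [Ky net]]] := compact_net cK K0 e0.
pose X (l : 'rV[R]_n.+1) := \sum_i l 0 i *: y i.
have XD l : std_simplex l -> D (X l).
  by move=> [l0 l1]; apply: convex_set_sum => // i; exact: KD.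
(* Twice the positive part of [e - |y i - z|]: continuous in [z], and zero away from [y i]. *)
pose w i z : R := (e - `|y i - z|) + `|e - `|y i - z| |.
have w0 i z : 0 <= w i z by rewrite /w -lerBlDl sub0r ler_normr lexx orbT.
have w_neq0 i z : w i z != 0 -> `|y i - z| < e.
  apply: contraNT; rewrite -leNgt => h.
  by rewrite /w ler0_norm ?subr_le0// subrr.
pose W z := \sum_i w i z.
have W0 z : K z -> 0 < W z.
  move=> Kz; have [i yz] := net z Kz.
  rewrite /W (bigD1 i)//=; apply: ltr_pwDl; last exact: sumr_ge0.
  by rewrite /w ger0_norm ?subr_ge0 1?ltW// addr_gt0// subr_gt0.
pose g l := \row_i (w i (f (X l)) / W (f (X l))).
have gS l : std_simplex l -> std_simplex (g l).
  move=> sl; have WW := W0 _ (fK _ (XD _ sl)); split=> [i|].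
    by rewrite mxE divr_ge0// ltW.
  by under eq_bigr do rewrite mxE; rewrite -mulr_suml divff// gt_eqF.
have gc : {within @std_simplex R n.+1, continuous g}.
  apply/subspace_continuousP => l sl; apply: cvg_rowP => i; rewrite mxE.
  under eq_fun do rewrite mxE.
  have Xc : X @ within (@std_simplex R n.+1) (nbhs l) --> within D (nbhs (X l)).
    apply: cvg_into_within; last first.
      by apply: filterS (withinT _ _) => m; exact: XD.
    apply: cvg_within_filter; apply: (@cvg_big E _ +%R 0 xpredT).
      exact: add_continuous.
    by move=> j _; apply: cvgZ (cvg_cst _); exact: coord_continuous.
  have fXc : (f \o X) @ within (@std_simplex R n.+1) (nbhs l) --> f (X l).
    apply: cvg_comp Xc _; move/subspace_continuousP : fc; apply; exact: XD.
  have wc j : w j (f (X m)) @[m --> within (@std_simplex R n.+1) (nbhs l)] -->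
      w j (f (X l)).
    have a : e - `|y j - f (X m)| @[m --> within (@std_simplex R n.+1) (nbhs l)]
        --> e - `|y j - f (X l)|.
      apply: cvgB; first exact: cvg_cst.
      by apply: cvg_norm; apply: cvgB => //; exact: cvg_cst.
    by apply: cvgD => //; exact: cvg_norm.
  apply: cvgM; first exact: wc.
  apply: cvgV; first by rewrite gt_eqF//; exact/W0/fK/XD.
  by apply: (@cvg_big _ _ +%R 0 xpredT); first exact: add_continuous.
have [l sl gl] := brouwer_simplex gS gc.
exists (X l); first exact: XD.
have [l0 l1] := sl.
set z := f (X l).
have -> : X l - z = \sum_i l 0 i *: (y i - z).
  under eq_bigr do rewrite scalerBr.
  by rewrite sumrB -scaler_suml l1 scale1r.
have le_e i : `|l 0 i *: (y i - z)| <= l 0 i * e.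
  rewrite normrZ (ger0_norm (l0 i)).
  have [->|li] := eqVneq (l 0 i) 0; first by rewrite !mul0r.
  apply/ler_wpM2l/ltW/w_neq0 => //; apply: contra li.
  by rewrite -gl mxE => /eqP ->; rewrite mul0r.
have [i li] : exists i, l 0 i != 0.
  apply/existsP; rewrite -[X in is_true X]negbK; apply/negP => /existsPn h.
  move: l1; rewrite big1 => [/eqP|i _]; first by rewrite eq_sym oner_eq0.
  by apply/eqP; have := h i; rewrite negbK.
apply: le_lt_trans (ler_norm_sum _ _ _) _.
rewrite -[ltRHS]mul1r -l1 mulr_suml.
rewrite (bigD1 i)//= [ltRHS](bigD1 i)//=; apply: ltr_leD; last exact: ler_sum.
rewrite normrZ (ger0_norm (l0 i)) ltr_pM2l; last by rewrite lt_neqAle eq_sym li l0.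
apply: w_neq0; apply: contra li.
by rewrite -gl mxE => /eqP ->; rewrite mul0r.
Qed.

Lemma schauder (R : realType) (E : normedModType R) (D K : set E) (f : E -> E) :
  convex_set D -> D !=set0 -> compact K -> K `<=` D ->
  {within D, continuous f} -> (forall x, D x -> K (f x)) ->
  exists2 x, K x & f x = x.
Proof.
move=> cD [d0 Dd0] cK KD fc fK.
have K0 : K !=set0 by exists (f d0); exact: fK.
have ex_x (n : nat) : exists x, D x /\ `|x - f x| < n.+1%:R^-1.
  have [|x Dx xf] := @schauder_approx R E D K f n.+1%:R^-1 cD cK K0 KD fc fK.
    by rewrite invr_gt0.
  by exists x.
have [x hx] := choice ex_x.
(* The cluster point is taken for the images, which lie in the compact [K]; so it lies in [D] even
   when [D] is not closed, as for the punctured cone. *)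
have [z Kz zx] := compact_seq_cluster cK (fun n => fK _ (hx n).1).
exists z => //; apply/eqP; rewrite -subr_eq0 -normr_le0; apply/ler_addgt0Pl => e e0.
rewrite addr0.
have e2 : 0 < e / 2 by rewrite divr_gt0.
have /within_continuousP/(_ z (KD _ Kz) _ e2)[d dgt0 hd] := fc.
have d'0 : 0 < Num.min d e / 2 by rewrite divr_gt0// lt_min dgt0.
have [N hN] := @inv_nat_small R 1 _ ler01 d'0.
have [n Nn zn] := zx _ N d'0.
have [Dx xn] := hx n.
have zxn : `|z - x n| < d.
  have -> : z - x n = (z - f (x n)) + (f (x n) - x n) by rewrite addrA subrK.
  apply: le_lt_trans (ler_normD _ _) _; rewrite (distrC (f _)).
  have := hN n Nn; rewrite div1r => h.
  have := ltrD zn (lt_trans xn h); rewrite -splitr => /lt_le_trans; apply.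
  by rewrite ge_min lexx.
have -> : f z - z = (f z - f (x n)) + (f (x n) - z) by rewrite addrA subrK.
apply: le_trans (ler_normD _ _) _; rewrite (distrC (f (x n))).
rewrite (splitr e) lerD// ltW//; first exact: hd.
apply: lt_le_trans zn _; rewrite ler_pM2r ?invr_gt0//.
by rewrite ge_min lexx orbT.
Qed.

Lemma norm_rescale (R : realType) (E : normedModType R) (v : E) (s : R) :
  v != 0 -> 0 <= s -> `|(s / `|v|) *: v| = s.
Proof.
move=> v0 s0; have nv : 0 < `|v| by rewrite normr_gt0.
by rewrite normrZ ger0_norm ?divr_ge0// divfK// gt_eqF.
Qed.

(** * Cones and bilinear forms *)

Section Cone.
Variables (R : realType) (E : completeNormedModType R) (P : set E).
Hypothesis P_cone : is_cone P.

Lemma cone0 : P 0.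
Proof.
have /set0P[x Px] : P != set0 by apply/eqP; exact: cone_neq_set0 P_cone.
by have := cone_scale P_cone Px (lexx 0); rewrite scale0r.
Qed.

Lemma coneD x y : P x -> P y -> P (x + y).
Proof.
move=> Px Py; have half : 0 <= 2^-1 :> R by rewrite invr_ge0.
have half1 : 2^-1 <= 1 :> R by lra.
have := (convex_setP P).1 (cone_convex P_cone) _ _ _ Px Py half half1.
rewrite [1 - 2^-1](_ : _ = 2^-1); last by lra.
rewrite -scalerDr => /(cone_scale P_cone)/(_ (ler0n _ 2)).
by rewrite scalerA divff// scale1r.
Qed.

Lemma cone_neq0 : exists2 x, P x & x != 0.
Proof.
apply: contrapT => h; apply: (cone_neq_set1 P_cone).
apply/seteqP; split=> [x Px|x ->]; last exact: cone0.
by apply: contrapT => /eqP x0; apply: h; exists x.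
Qed.

Lemma coneD_eq0 x y : P x -> P y -> x + y = 0 -> x = 0.
Proof.
move=> Px Py /eqP; rewrite addr_eq0 => /eqP e.
by apply: (cone_pointed P_cone) => //; rewrite e opprK.
Qed.

(** Two elements of a pointed cone with sum 0 both vanish. This is the domain used in
    [cone_expansion], where vectors are divided by their norms. *)
Lemma cone_setD0_convex : convex_set (P `\ 0).
Proof.
apply/convex_setP => x y t [Px /eqP x0] [Py /eqP y0] t0 t1.
have Ptx := cone_scale P_cone Px t0.
have t1' : 0 <= 1 - t by rewrite subr_ge0.
have Pty := cone_scale P_cone Py t1'.
split; first exact: coneD.
move=> /= e; have /eqP := coneD_eq0 Ptx Pty e.
rewrite scaler_eq0 (negbTE x0) orbF => /eqP t_0.
by move: e; rewrite t_0 scale0r add0r subr0 scale1r => /eqP; rewrite (negbTE y0).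
Qed.

(* Schauder's theorem applies to compressions; the expansion [T] is turned into
   one by exchanging the radii: [sg] reverses the interval [r, s], [w v] has norm
   [sg v], and the fixed points of [G] correspond to those of [T] under [w]. *)
Lemma cone_expansion (T : E -> E) (K : set E) (r s : R) :
  0 < r -> r < s -> {within P, continuous T} -> compact K -> K `<=` P -> ~ K 0 ->
  (forall u, P u -> r <= `|u| <= s -> K (T u)) ->
  (forall u, P u -> `|u| = r -> `|T u| < r) ->
  (forall u, P u -> `|u| = s -> s < `|T u|) ->
  exists2 u, P u & r < `|u| /\ T u = u.
Proof.
move=> r0 rs Tc cK KP K0 TK Tr Ts.
have s0 : 0 < s := lt_trans r0 rs.
(* [r + s - |v|] is clamped to [[r, s]], so that [w v] lies in the shell for every nonzero [v]. *)
pose sg (v : E) : R := Num.max r (Num.min s (r + s - `|v|)).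
have sgr v : r <= sg v by rewrite le_max lexx.
have sgs v : sg v <= s by rewrite ge_max (ltW rs) ge_min lexx.
have sg0 v : 0 < sg v := lt_le_trans r0 (sgr v).
pose w (v : E) := (sg v / `|v|) *: v.
pose k v := (r + s - sg v) / sg v.
pose G v := k v *: T (w v).
have nw v : v != 0 -> `|w v| = sg v.
  by move=> v0; apply: norm_rescale => //; exact: ltW.
have Pw v : P v -> P (w v).
  by move=> Pv; apply: (cone_scale P_cone) => //; rewrite divr_ge0// ltW.
have kr v : r / s <= k v.
  rewrite ler_pM// ?invr_ge0 ?(ltW r0) ?(ltW s0)//; first by have := sgs v; lra.
  by rewrite lef_pV2 ?posrE.
have ks v : k v <= s / r.
  have h : 0 <= r + s - sg v by have := sgs v; lra.
  rewrite ler_pM// ?invr_ge0 ?(ltW (sg0 v))//; first by have := sgr v; lra.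
  by rewrite lef_pV2 ?posrE.
(* As [k] stays in [[r / s, s / r]], the values of [G] lie in this compact set, which avoids 0
   because [K] does. *)
pose KG := (fun p : R^o * E => p.1 *: p.2) @` (`[r / s, s / r] `*` K).
have cKG : compact KG.
  apply: continuous_compact; last by apply: compact_setX => //; exact: segment_compact.
  apply: continuous_subspaceT => p.
  by apply: cvgZ; [exact: cvg_fst|exact: cvg_snd].
have KGD : KG `<=` P `\ 0.
  move=> _ [[a z] /= [ha Kz] <-].
  have a0 : 0 < a.
    by move: ha; rewrite in_itv/= => /andP[+ _]; apply: lt_le_trans; rewrite divr_gt0.
  split; first by apply: (cone_scale P_cone); [exact: KP|exact: ltW].
  move=> /= /eqP; rewrite scaler_eq0 gt_eqF//= => /eqP z0.
  by apply: K0; rewrite -z0.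
have GK v : (P `\ 0) v -> KG (G v).
  move=> [Pv /eqP v0]; exists (k v, T (w v)) => //; split=> /=.
    by rewrite in_itv/= kr ks.
  by apply: TK; rewrite ?nw ?sgr ?sgs//; exact: Pw.
have sgc : continuous (sg : E -> R^o).
  move=> v; apply: (@continuous_max _ _ (fun=> r) (fun z => Num.min s (r + s - `|z|))).
    exact: cvg_cst.
  apply: (@continuous_min _ _ (fun=> s) (fun z => r + s - `|z|)).
    exact: cvg_cst.
  apply: cvgB; first exact: cvg_cst.
  exact: norm_continuous.
have Gc : {within P `\ 0, continuous G}.
  apply/subspace_continuousP => v [Pv /eqP v0].
  have wc : w @ within (P `\ 0) (nbhs v) --> within P (nbhs (w v)).
    apply: cvg_into_within; last first.
      by apply: filterS (withinT _ _) => z [Pz _]; exact: Pw.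
    apply: cvg_within_filter; apply: cvgZ; last exact: cvg_id.
    apply: cvgM; first exact: sgc.
    by apply: cvgV; [rewrite normr_eq0|exact: norm_continuous].
  apply: cvgZ.
    apply: cvg_within_filter; apply: cvgM; last by apply: cvgV; [rewrite gt_eqF|exact: sgc].
    by apply: cvgB; [exact: cvg_cst|exact: sgc].
  by apply: cvg_comp wc _; move/subspace_continuousP : Tc; apply; exact: Pw.
have D0 : (P `\ 0) !=set0 by have [x Px /eqP x0] := cone_neq0; exists x.
have [v /KGD[Pv /eqP v0] Gv] := schauder cone_setD0_convex D0 cKG KGD Gc GK.
have nv : `|v| = k v * `|T (w v)|.
  by rewrite -{1}Gv normrZ ger0_norm// (le_trans _ (kr v))// divr_ge0 ?ltW.
(* If [|v| < r], then [w v] has norm [s] and [k v = r / s], so expansion at [s] gives [|v| > r].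
   Symmetrically, [|v| > s] contradicts compression at [r]. *)
have [vr|rv] := ltP `|v| r.
  have e : sg v = s by rewrite /sg min_l ?max_r ?(ltW rs)//; lra.
  have := Ts (w v) (Pw v Pv); rewrite nw// e => /(_ erefl) h.
  move: vr; rewrite nv /k e addrK mulrAC ltr_pdivrMr// ltr_pM2l// => /(lt_trans h).
  by rewrite ltxx.
have [sv|vs] := ltP s `|v|.
  have e : sg v = r.
    by rewrite /sg max_l// ge_min; apply/orP; right; lra.
  have := Tr (w v) (Pw v Pv); rewrite nw// e => /(_ erefl) h.
  move: sv; rewrite nv /k e addrAC subrr add0r mulrAC ltr_pdivlMr// ltr_pM2l//.
  by move=> /lt_trans/(_ h); rewrite ltxx.
have e : sg v = r + s - `|v| by rewrite /sg min_r ?max_r//; lra.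
(* Between the radii [k v = |v| / sg v], which exactly undoes the rescaling in [w]. *)
have Tw : T (w v) = w v.
  rewrite [RHS](_ : _ = (sg v / `|v|) *: G v); last by rewrite Gv.
  rewrite scalerA /k.
  rewrite (_ : r + s - sg v = `|v|); last by rewrite e; lra.
  rewrite mulrA divfK ?normr_eq0// divff ?scale1r// gt_eqF//.
exists (w v); first exact: Pw.
split=> //; rewrite lt_neqAle nw// sgr andbT; apply/eqP => e'.
by have := Tr (w v) (Pw v Pv); rewrite Tw nw// -e' ltxx => /(_ erefl).
Qed.

End Cone.

(** * Estimates and compactness for the form on the diagonal *)

Section Form.
Variables (R : realType) (E : completeNormedModType R).
Variables (P : set E) (b : E -> E -> E).
Hypotheses (P_cone : is_cone P) (b_bilinear : cone_bilinear P b).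
Hypothesis b_compact : cone_compact P b.

Lemma form_le u v : P u -> P v -> `|b u v| <= form_norm P b * `|u| * `|v|.
Proof. by have [[_ +] _] := form_norm_least P_cone b_bilinear b_compact; apply. Qed.

Lemma form_scale_diag (t : R) u :
  P u -> 0 <= t -> b (t *: u) (t *: u) = t ^+ 2 *: b u u.
Proof.
move=> Pu t0; have Ptu := cone_scale P_cone Pu t0.
have [+ _] := b_bilinear Pu Pu Ptu t0 (lexx 0).
rewrite !scale0r !addr0 => ->.
have [_ +] := b_bilinear Pu Pu Pu t0 (lexx 0).
by rewrite !scale0r !addr0 => ->; rewrite scalerA.
Qed.

Lemma coercivity_le u : P u -> coercivity_const P b * `|u| ^+ 2 <= `|b u u|.
Proof.
move=> Pu; have [->|u0] := eqVneq u 0; first by rewrite normr0 expr0n mulr0.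
have nu : 0 < `|u| by rewrite normr_gt0.
have iu : 0 <= `|u|^-1 by rewrite invr_ge0.
have : coercivity_const P b <= `|b (`|u|^-1 *: u) (`|u|^-1 *: u)|.
  apply: ge_inf; first by exists 0 => _ [x _ <-].
  exists (`|u|^-1 *: u) => //; split; first exact: (cone_scale P_cone Pu iu).
  by rewrite normrZ ger0_norm// mulVf// gt_eqF.
rewrite form_scale_diag// normrZ ger0_norm ?exprn_ge0//.
by rewrite exprVn mulrC ler_pdivlMr// exprn_gt0.
Qed.

(** On a nonzero [x] in [P] the coercive lower bound and the norm bound for [b x x] are both
    multiples of [|x|^2]. *)
Lemma form_norm_gt0 : 0 < coercivity_const P b -> 0 < form_norm P b.
Proof.
move=> c0; have [x Px x0] := cone_neq0 P_cone.
have x2 : 0 < `|x| ^+ 2 by rewrite exprn_gt0// normr_gt0.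
rewrite -(pmulr_lgt0 _ x2) (lt_le_trans (mulr_gt0 c0 x2))//.
by apply: le_trans (coercivity_le Px) _; rewrite expr2 mulrA form_le.
Qed.

Lemma continuous_form_diag : {within P, continuous (fun u => b u u)}.
Proof.
apply/subspace_continuousP => u Pu.
have /subspace_continuousP/(_ (u, u) (conj Pu Pu)) bc := b_compact.1.
apply: (cvg_comp (fun x => (x, x)) (fun p => b p.1 p.2) _ bc).
apply: cvg_into_within.
  by apply: cvg_within_filter; apply: cvg_pair; exact: cvg_id.
by apply: filterS (withinT _ _) => x Px.
Qed.

Lemma compact_form_diag (m : R) : exists2 K, compact K &
  forall u, P u -> `|u| <= m -> K (b u u).
Proof.
pose A := [set p : E * E | [/\ P p.1, P p.2, `|p.1| <= m & `|p.2| <= m]].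
have AP : A `<=` P `*` P by move=> p [].
have bA : bounded_set A.
  exists m; split; first exact: num_real.
  move=> M mM p [_ _ p1 p2] /=; rewrite prod_normE ge_max.
  by rewrite (le_trans p1 (ltW mM)) (le_trans p2 (ltW mM)).
have := b_compact.2 A AP bA; rewrite precompactE => cA.
eexists; first exact: cA.
by move=> u Pu um; apply: subset_closure; exists (u, u).
Qed.

End Form.

(** * The two solutions *)

Theorem theorem2p2 (R : realType) (E : completeNormedModType R)
    (P : set E) (b : E -> E -> E)
    (P_cone : is_cone P)
    (bP : maps_cone P b)
    (b_bilinear : cone_bilinear P b)
    (b_compact : cone_compact P b)
    (b_coercive : 0 < coercivity_const P b)
    (u0 : E) (Pu0 : P u0)
    (small : 4 * form_norm P b * `|u0| < 1) :
  exists u v : E,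
    [/\ P u, P v, u <> v, u = b u u + u0 & v = b v v + u0].
Proof.
set N := form_norm P b in small; set c := coercivity_const P b in b_coercive.
have N0 : 0 < N by exact: form_norm_gt0.
pose F u := b u u + u0.
have FP u : P u -> P (F u) by move=> Pu; apply: coneD => //; exact: bP.
have Fc : {within P, continuous F}.
  apply/subspace_continuousP => u Pu; apply: cvgD; last exact: cvg_cst.
  by move/subspace_continuousP : (continuous_form_diag b_compact); apply.
have shift_compact K : compact K -> compact ((fun z => z + u0) @` K).
  apply: continuous_compact; apply: continuous_subspaceT => z.
  by apply: cvgD; [exact: cvg_id|exact: cvg_cst].
(* With this radius [|b u u| <= N * r * r = r / 2] on the ball, and the smallness assumption reads
   [|u0| < r / 2]. *)
pose r := (2 * N)^-1.
have r0 : 0 < r by rewrite invr_gt0 mulr_gt0.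
have Nr : N * r = 2^-1 by rewrite /r invfM mulrCA divff ?mulr1// gt_eqF.
have small' : `|u0| < r / 2.
  rewrite /r -invfM -[ltRHS]div1r ltr_pdivlMr ?mulr_gt0//.
  by move: small; rewrite (_ : _ * _ * _ = `|u0| * (2 * N * 2))//; ring.
have F_lt u : P u -> `|u| <= r -> `|F u| < r.
  move=> Pu ur; apply: le_lt_trans (ler_normD _ _) _.
  rewrite [ltRHS](splitr r) ler_ltD//.
  apply: le_trans (form_le P_cone b_bilinear b_compact Pu Pu) _.
  have : N * `|u| * `|u| <= N * r * r by rewrite !ler_pM// ?mulr_ge0// ltW.
  by rewrite Nr [2^-1 * r]mulrC.
have closed_norm_le (a : R) : closed [set x : E | `|x| <= a].
  apply: (@preimage_closed _ _ (fun x : E => `|x|) [set y | y <= a]); last exact: closed_le.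
  by move=> x _; exact: norm_continuous.
have closed_norm_ge (a : R) : closed [set x : E | a <= `|x|].
  apply: (@preimage_closed _ _ (fun x : E => `|x|) [set y | a <= y]); last exact: closed_ge.
  by move=> x _; exact: norm_continuous.
have [u [Pu ur] Fu] : exists2 u, P u /\ `|u| <= r & F u = u.
  have [K cK bK] := compact_form_diag b_compact r.
  pose D := P `&` [set x | `|x| <= r].
  have cD : compact (((fun z => z + u0) @` K) `&` D).
    apply: compact_closedI; first exact: shift_compact.
    by apply: closedI => //; exact: cone_closed P_cone.
  have convD : convex_set D.
    apply/convex_setP => x y t [Px xr] [Py yr] t0 t1.
    have t1' : 0 <= 1 - t by rewrite subr_ge0.
    split; first by apply: coneD => //; apply: (cone_scale P_cone).
    rewrite /= (le_trans (ler_normD _ _))// !normrZ !ger0_norm//.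
    apply: le_trans (lerD (ler_wpM2l t0 xr) (ler_wpM2l t1' yr)) _.
    by rewrite -mulrDl subrKC mul1r.
  have D0 : D !=set0 by exists 0; split; [exact: cone0|rewrite /= normr0 ltW].
  have DF : {within D, continuous F}.
    by apply: continuous_subspaceW Fc; exact: subIsetl.
  have [||u [_ Du] Fu] := schauder convD D0 cD _ DF; last by exists u.
    exact: subIsetr.
  move=> x [Px xr]; split; first by exists (b x x) => //; exact: bK.
  by split; [exact: FP|exact/ltW/F_lt].
(* Here [c * s > 1 + |u0|] and [s >= 1], whence [c * s ^+ 2 > s + |u0|]; the summand [r] places [s]
   beyond [r]. *)
pose s := r + 1 + (1 + `|u0|) / c.
have t0 : 0 < (1 + `|u0|) / c by rewrite divr_gt0// ltr_wpDr.
have rs : r < s by rewrite /s; lra.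
have s0 : 0 < s := lt_trans r0 rs.
have F_gt v : P v -> `|v| = s -> s < `|F v|.
  move=> Pv vs; have := coercivity_le P_cone b_bilinear Pv; rewrite vs -/c => h.
  have : `|b v v| <= `|F v| + `|u0|.
    by have := ler_normB (F v) u0; rewrite /F addrK.
  have : c * s = c * r + c + (1 + `|u0|).
    by rewrite /s !mulrDr mulr1 mulrCA divff ?mulr1// gt_eqF.
  have : 1 <= s by rewrite /s; lra.
  have := normr_ge0 u0; have : 0 < c * r by rewrite mulr_gt0.
  move: h; rewrite expr2 mulrA; clearbody c s; nra.
have [K cK bK] := compact_form_diag b_compact s.
(* Coercivity bounds [|b x x|] below by [c * r ^+ 2] on the shell. This keeps 0 out of [K'] and, by
   pointedness, out of its translate by [u0]. *)
pose K' := K `&` (P `&` [set z | c * r ^+ 2 <= `|z|]).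
have cK' : compact ((fun z => z + u0) @` K').
  apply: shift_compact; apply: compact_closedI => //.
  by apply: closedI => //; exact: cone_closed P_cone.
have [|||||v Pv [rv Fv]] := cone_expansion P_cone r0 rs Fc cK'.
- by move=> _ [z [_ [Pz _]] <-]; exact: coneD.
- move=> [z [_ [Pz hz]] e]; have z0 := coneD_eq0 P_cone Pz Pu0 e.
  by move: hz; rewrite z0 /= normr0 leNgt mulr_gt0// exprn_gt0.
- move=> x Px /andP[rx xs]; exists (b x x) => //; split; first exact: bK.
  split; first exact: bP.
  rewrite /=; apply: le_trans (coercivity_le P_cone b_bilinear Px).
  by rewrite ler_pM2l// lerXn2r ?nnegrE// ltW.
- by move=> x Px xr; apply: F_lt => //; rewrite xr.
- exact: F_gt.
exists u, v; split=> //.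
by move=> uv; move: rv; rewrite -uv ltNge ur.
Qed.
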